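(* Let $X$ and $Y$ be connected CW complexes and let $p\colon Y\to X$ be a covering map. Then $\mathrm{dcat}_1(Y)\le \mathrm{dcat}_1(X)$.
   Context: All spaces are connected CW complexes and maps are continuous. For a space $Z$ and an integer $n\ge 1$, let $\mathcal B_n(Z)$ be the set of probability measures on $Z$ supported on at most $n$ points, i.e. formal sums $\sum_{i=1}^n a_i z_i$ with $z_i\in Z$, $a_i\ge 0$, $\sum a_i=1$ (a point $z$ standing for the Dirac measure $\delta_z$). It carries the topology of weak convergence of measures; for metric $Z$ this is the topology of the Lévy–Prokhorov metric. For a map $f\colon E\to B$ put $E_n=\{\mu\in\mathcal B_n(E)\mid \mathrm{supp}(\mu)\subset f^{-1}(b)\text{ for some } b\in B\}$, a subspace of $\mathcal B_n(E)$, and let $f_n\colon E_n\to B$ send $\mu$ to that $b$. If $f$ is a fibration, then so is $f_n$. The distributional one-category $\mathrm{dcat}_1(X)$ is the least integer $n\ge 0$ such that $q^X_{n+1}\colon \widetilde X_{n+1}\to X$ has a section, where $q^X\colon\widetilde X\to X$ is the universal covering ($\infty$ if no such $n$ exists). *)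

(* Defs.v *)
From HB Require Import structures.
From mathcomp Require Import all_boot all_order all_algebra finmap.
From mathcomp Require Import all_classical all_reals all_analysis.
Import Order.TTheory GRing.Theory Num.Theory numFieldNormedType.Exports.

Set Implicit Arguments.
Unset Strict Implicit.
Unset Printing Implicit Defensive.

Local Open Scope classical_set_scope.
Local Open Scope ring_scope.

Section Spaces.
Context {R : realType}.

Definition restricts_to_homeo {S T : topologicalType} (f : S -> T)
    (A : set S) (B : set T) : Prop :=
  [/\ set_bij A B f, {within A, continuous f} &
      exists2 g : T -> S, {within B, continuous g} & {in A, cancel f g}].

Definition connected_space (X : topologicalType) : Prop :=
  [set: X] !=set0 /\ connected [set: X].

(* The norm of the library on ['rV[R]_n] is the sup norm, so the Euclidean
   ball and sphere are written with the sum of squares. *)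
Definition sqnorm {n : nat} (v : 'rV[R]_n) : R := \sum_(i < n) v ord0 i ^+ 2.

Definition disk (n : nat) : set 'rV[R]_n := [set v | sqnorm v <= 1].
Definition open_disk (n : nat) : set 'rV[R]_n := [set v | sqnorm v < 1].
Definition sphere (n : nat) : set 'rV[R]_n := [set v | sqnorm v = 1].
Arguments disk : clear implicits.
Arguments open_disk : clear implicits.
Arguments sphere : clear implicits.

Record cw_structure (X : topologicalType) := CWStructure {
  cw_index : Type;
  cw_dim : cw_index -> nat;
  cw_char : forall i, 'rV[R]_(cw_dim i) -> X;
  cw_hausdorff : hausdorff_space X;
  cw_char_continuous : forall i, {within disk (cw_dim i), continuous (@cw_char i)};
  cw_char_homeo : forall i, restricts_to_homeo (@cw_char i)
    (open_disk (cw_dim i)) (@cw_char i @` open_disk (cw_dim i));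
  cw_cells_disjoint :
    trivIset [set: cw_index] (fun i => @cw_char i @` open_disk (cw_dim i));
  cw_cells_cover : \bigcup_i (@cw_char i @` open_disk (cw_dim i)) = [set: X];
  cw_closure_finite : forall i, exists F : set cw_index,
    [/\ finite_set F, (forall j, F j -> (cw_dim j < cw_dim i)%N) &
        @cw_char i @` sphere (cw_dim i) `<=`
          \bigcup_(j in F) (@cw_char j @` open_disk (cw_dim j))];
  cw_weak : forall A : set X,
    (forall i, closed (A `&` (@cw_char i @` disk (cw_dim i)))) -> closed A }.

Definition CW_complex (X : topologicalType) : Prop := inhabited (cw_structure X).

Definition covering_map {E B : topologicalType} (p : E -> B) : Prop :=
  [/\ continuous p, range p = [set: B] &
      forall b : B, exists2 U : set B, open U /\ U b &
        exists C : set (set E),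
          [/\ C `<=` open, trivIset C id, p @^-1` U = \bigcup_(V in C) V &
              forall V, C V -> restricts_to_homeo p V U]].

Definition path_connected (E : topologicalType) : Prop :=
  [set: E] !=set0 /\
  forall x y : E, exists g : R -> E,
    [/\ {within `[0, 1], continuous g}, g 0 = x & g 1 = y].

Definition simply_connected (E : topologicalType) : Prop :=
  path_connected E /\
  forall g : R -> E, {within `[0, 1], continuous g} -> g 0 = g 1 ->
  exists H : R * R -> E,
    [/\ {within `[0, 1]%classic `*` `[0, 1]%classic, continuous H},
        (forall t : R, t \in `[0, 1] -> H (t, 0) = g t /\ H (t, 1) = g 0) &
        (forall s : R, s \in `[0, 1] -> H (0, s) = g 0 /\ H (1, s) = g 0)].

Definition universal_covering {E B : topologicalType} (q : E -> B) : Prop :=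
  covering_map q /\ simply_connected E.

End Spaces.

Section Measures.
Context {R : realType}.

Definition bounded_continuous (Z : topologicalType) : set (Z -> R) :=
  [set g | continuous g /\ exists M : R, forall z, `|g z| <= M].
Arguments bounded_continuous : clear implicits.

(* Formal real combinations of points of [Z]: [mu] is the measure
   [sum_z mu z * delta_z]. *)
Definition fin_measure (Z : topologicalType) : Type := {fsfun Z -> R with 0}.

HB.instance Definition _ (Z : topologicalType) := Choice.on (fin_measure Z).

Definition supp {Z : topologicalType} (mu : fin_measure Z) : {fset Z} :=
  finsupp (mu : {fsfun Z -> R with 0}).

Definition weight {Z : topologicalType} (mu : fin_measure Z) (z : Z) : R :=
  (mu : {fsfun Z -> R with 0}) z.

Definition integral_against {Z : topologicalType} (mu : fin_measure Z)
    : {ptws bounded_continuous Z -> R} :=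
  fun g => \sum_(z <- supp mu) weight mu z * set_val g z.

(* Topology of weak convergence: the coarsest one for which integration
   against each bounded continuous function is continuous. *)
HB.instance Definition _ (Z : topologicalType) :=
  Topological.copy (fin_measure Z) (initial_topology (@integral_against Z)).

Definition Bn (n : nat) (Z : topologicalType) : set (fin_measure Z) :=
  [set mu | [/\ (#|` supp mu| <= n)%N, forall z, 0 <= weight mu z &
                \sum_(z <- supp mu) weight mu z = 1]].

Definition fib_measures (n : nat) {E B : topologicalType} (f : E -> B)
    : set (fin_measure E) :=
  [set mu | @Bn n E mu /\ exists b : B, [set` supp mu] `<=` f @^-1` [set b]].

Lemma fib_measures_base n (E B : topologicalType) (f : E -> B)
    (mu : fib_measures n f) :
  exists b : B, [set` supp (set_val mu)] `<=` f @^-1` [set b].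
Proof. by have [] := set_valP mu. Qed.

(* The point chosen is unique, as a probability measure has nonempty
   support. *)
Definition fib_map (n : nat) {E B : topologicalType} (f : E -> B)
    (mu : fib_measures n f) : B :=
  projT1 (cid (fib_measures_base mu)).

End Measures.

Definition has_section {E B : topologicalType} (f : E -> B) : Prop :=
  exists2 s : B -> E, continuous s & forall b, f (s b) = b.

(* Universal coverings of a connected CW complex are unique up to isomorphism
   over it, so it does not matter which one is used. *)
Definition dcat1_le (R : realType) (X : topologicalType) (n : nat) : Prop :=
  exists (E : topologicalType) (q : E -> X),
    @universal_covering R E X q /\ has_section (@fib_map R n.+1 E X q).

Lemma dcat1_le_bool (R : realType) (X : topologicalType) :
  (exists n, dcat1_le R X n) -> exists n, `[< dcat1_le R X n >].
Proof. by move=> [n Hn]; exists n; apply/asboolP. Qed.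

Definition dcat1 (R : realType) (X : topologicalType) : \bar R :=
  match pselect (exists n, dcat1_le R X n) with
  | left h => ((ex_minn (dcat1_le_bool h))%:R)%:E
  | right _ => +oo%E
  end.

(* Main.v *)
(** The universal covering [q : E -> X] lifts through [p] to a covering [q' : E -> Y] with [p \o q' = q], and [q'] is a universal covering of [Y]. The pullback [{(y, e) | p y = q e}] is a covering of the simply connected space [E], hence a disjoint union of copies of [E]; mapping each copy to [E] by a deck transformation of [q] gives a map [translate] into [E] over [Y]. A section [s] of [q_(n+1)] then yields the section of [q'_(n+1)] that sends [y] to the image of the measure [s (p y)] under [translate y]. Two facts about a CW complex [X] enter: local path connectedness, for the lifting criterion, and complete regularity: [translate] is continuous only locally over [X], whereas the weak topology on measures is tested by functions defined on all of [E], so that test functions have to be cut off. *)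

Require Import Defs.
From mathcomp Require Import all_boot all_order all_algebra finmap.
From mathcomp Require Import all_classical all_reals all_analysis.
From mathcomp Require Import ring lra.
Import Order.TTheory GRing.Theory Num.Theory numFieldNormedType.Exports.

Set Implicit Arguments.
Unset Strict Implicit.
Unset Printing Implicit Defensive.

Local Open Scope classical_set_scope.
Local Open Scope ring_scope.

(** * Paths *)

Lemma within_contP {S T : topologicalType} (A : set S) (f : S -> T) :
  {within A, continuous f} <->
  forall x, A x -> forall W, nbhs (f x) W -> \forall z \near x, A z -> W (f z).
Proof. exact: subspace_continuousP. Qed.

Section WithinContinuity.
Context {S T U : topologicalType}.

Lemma within_cont_comp (A : set S) (B : set T) (f : S -> T) (g : T -> U) :
  {within A, continuous f} -> {within B, continuous g} ->
  (forall x, A x -> B (f x)) -> {within A, continuous (g \o f)}.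
Proof.
move=> /within_contP cf /within_contP cg AB; apply/within_contP => x Ax W nW.
have := cf x Ax _ (cg _ (AB _ Ax) _ nW).
by apply: filterS => z h Az; apply: h => //; exact: AB.
Qed.

Lemma within_cont_eq (A : set S) (f g : S -> T) :
  (forall x, A x -> f x = g x) ->
  {within A, continuous f} -> {within A, continuous g}.
Proof.
move=> fg; apply: subspace_eq_continuous => x /set_mem Ax; exact: fg.
Qed.

Lemma within_cont_open (A : set S) (f : S -> T) : open A ->
  {within A, continuous f} -> forall x, A x -> {for x, continuous f}.
Proof.
move=> oA /within_contP cf x Ax W /(cf x Ax) nW.
have := open_nbhs_nbhs (conj oA Ax).
by apply: filterS2 nW => z; apply.
Qed.

(** Connectedness as an induction principle: inside [A] both [P] and its negation spread to nearby
    points, so [P] holds on a nonempty relatively clopen subset of [A]. *)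
Lemma connected_ind (A : set S) (P : S -> Prop) (x0 : S) : connected A ->
  A x0 -> P x0 -> (forall x, A x -> P x -> \forall z \near x, A z -> P z) ->
  (forall x, A x -> ~ P x -> \forall z \near x, A z -> ~ P z) ->
  forall x, A x -> P x.
Proof.
move=> cA Ax0 Px0 oP cP.
pose O := [set x : S | \forall z \near x, A z -> P z].
pose O' := [set x : S | \forall z \near x, A z -> ~ P z].
have oO : open O.
  by rewrite openE => x Ox; exact: nbhs_interior.
have oO' : open O' by rewrite openE => x Ox; exact: nbhs_interior.
have AE : A `&` O = A.
  apply: cA.
  - by exists x0; split => //; exact: oP.
  - by exists O.
  (* Within [A] the sets [O] and [O'] are complementary, so the complement of the open set [O'] cuts
     out a relatively closed set. *)
  - exists (~` O'); first by apply: open_closedC.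
    apply/seteqP; split=> x [Ax]; rewrite /= => Ox; split => //.
    + by move=> O'x; apply: (nbhs_singleton O'x Ax); exact: (nbhs_singleton Ox Ax).
    + apply: oP => //; apply: contrapT => nP; apply: Ox; exact: cP.
by move=> x; rewrite -{1}AE => -[Ax /nbhs_singleton]; apply.
Qed.

End WithinContinuity.

Section Paths.
Context {R : realType}.

Lemma unit_itvE (t : R) : `[0, 1]%classic t <-> 0 <= t <= 1.
Proof. by rewrite /= in_itv. Qed.

Definition path_on (T : topologicalType) (g : R -> T) : Prop :=
  {within `[0, 1], continuous g}.

Lemma affine_continuous (a b : R) : continuous (fun t : R => a * t + b).
Proof.
move=> t; apply: continuousD; last exact: cvg_cst.
by apply: continuousM; [exact: cvg_cst | exact: cvg_id].
Qed.

Lemma path_affine (T : topologicalType) (g : R -> T) (a b : R) (A : set R) :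
  path_on g -> (forall t, A t -> 0 <= a * t + b <= 1) ->
  {within A, continuous (fun t => g (a * t + b))}.
Proof.
move=> cg Aab.
have cab : {within A, continuous (fun t : R => a * t + b)}.
  by apply: continuous_subspaceT => x; exact: affine_continuous.
by apply: (within_cont_comp cab cg) => t /Aab /unit_itvE.
Qed.

(** Both branches keep the shape [a * t + b], with a trivial [+ 0] in the first, so that
    [path_affine] applies to each. *)
Definition path_cat (T : topologicalType) (g h : R -> T) (t : R) : T :=
  if t <= 2^-1 then g (2 * t + 0) else h (2 * t + (-1)).

Lemma path_catP (T : topologicalType) (g h : R -> T) :
  path_on g -> path_on h -> g 1 = h 0 -> path_on (path_cat g h).
Proof.
move=> cg ch gh; rewrite /path_on.
have -> : `[0, 1]%classic = `[0, 2^-1]%classic `|` `[2^-1, 1 : R]%classic.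
  apply/seteqP; split => t /=; rewrite !in_itv/=.
    by move=> /andP[? ?]; case: (leP t 2^-1) => ?; [left|right]; lra.
  by case => /andP[? ?]; lra.
apply: withinU_continuous; [exact: interval_closed|exact: interval_closed| |].
- apply: (within_cont_eq _ (@path_affine _ g 2 0 _ cg _)) => t /=;
    rewrite in_itv/= => /andP[? ?]; last by lra.
  by rewrite /path_cat ifT//.
- apply: (within_cont_eq _ (@path_affine _ h 2 (-1) _ ch _)) => t /=;
    rewrite in_itv/= => /andP[? ?]; last by lra.
  rewrite /path_cat; case: leP => // ?.
  have -> : t = 2^-1 by lra.
  have -> : 2 * 2^-1 + 0 = 1 :> R by lra.
  by have -> : 2 * 2^-1 + (-1) = 0 :> R by lra.
Qed.

Lemma path_cat0 (T : topologicalType) (g h : R -> T) : path_cat g h 0 = g 0.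
Proof. by rewrite /path_cat ifT ?mulr0 ?addr0//; lra. Qed.

Lemma path_cat1 (T : topologicalType) (g h : R -> T) : path_cat g h 1 = h 1.
Proof.
rewrite /path_cat ifF; last by lra.
by have -> : 2 * 1 + (-1) = 1 :> R by lra.
Qed.

Lemma path_cat_all (T : topologicalType) (g h : R -> T) (A : set T) :
  (forall t, 0 <= t <= 1 -> A (g t)) -> (forall t, 0 <= t <= 1 -> A (h t)) ->
  forall t, 0 <= t <= 1 -> A (path_cat g h t).
Proof.
move=> Ag Ah t t01; rewrite /path_cat; case: leP => ?; [apply: Ag|apply: Ah]; lra.
Qed.

Lemma path_rev (T : topologicalType) (g : R -> T) : path_on g ->
  path_on (fun t => g (-1 * t + 1)).
Proof. by move=> cg; apply: path_affine => // t /unit_itvE; lra. Qed.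

Definition joined (T : topologicalType) (A : set T) (x y : T) : Prop :=
  exists g : R -> T, [/\ path_on g, g 0 = x, g 1 = y &
    forall t, 0 <= t <= 1 -> A (g t)].

Lemma joined_refl (T : topologicalType) (A : set T) x : A x -> joined A x x.
Proof.
move=> Ax; exists (fun=> x); split => //.
by apply: continuous_subspaceT => ?; exact: cvg_cst.
Qed.

Lemma joined_trans (T : topologicalType) (A : set T) y x z :
  joined A x y -> joined A y z -> joined A x z.
Proof.
move=> [g [cg g0 g1 Ag]] [h [ch h0 h1 Ah]]; exists (path_cat g h); split.
- by apply: path_catP => //; rewrite g1.
- by rewrite path_cat0.
- by rewrite path_cat1.
- exact: path_cat_all.
Qed.

Lemma joined_sym (T : topologicalType) (A : set T) x y :
  joined A x y -> joined A y x.
Proof.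
move=> [g [cg g0 g1 Ag]]; exists (fun t => g (-1 * t + 1)); split.
- exact: path_rev.
- by rewrite mulr0 add0r.
- by rewrite mulr1 addNr.
- by move=> t t01; apply: Ag; lra.
Qed.

(** Points near [x] need only be joined to [x] inside [U]; by [joined_open] this already makes the
    path components of open sets open. *)
Definition locally_path_connected (T : topologicalType) : Prop :=
  forall (x : T) (U : set T), open U -> U x -> \forall z \near x, joined U x z.

Lemma joined_open (T : topologicalType) (U : set T) x :
  locally_path_connected T -> open U -> open [set z | joined U x z].
Proof.
move=> lT oU; rewrite openE => z jz.
have Uz : U z by case: jz => g [_ _ <- Ug]; apply: Ug; lra.
have := lT z U oU Uz; apply: filterS => w; exact: joined_trans.
Qed.

Lemma joined_subset (T : topologicalType) (U : set T) x :
  [set z | joined U x z] `<=` U.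
Proof. by move=> z [g [_ _ <- Ug]]; apply: Ug; lra. Qed.

Lemma joined_connected (T : topologicalType) (U : set T) x :
  U x -> connected [set z | joined U x z].
Proof.
move=> Ux.
have -> : [set z | joined U x z] =
    \bigcup_(g in [set g | [/\ path_on g, g 0 = x &
        forall t, 0 <= t <= 1 -> U (g t)]]) (g @` `[0, 1]%classic).
  apply/seteqP; split => z.
    move=> [g [cg g0 g1 Ug]]; exists g; first by split.
    by exists 1 => //; apply/unit_itvE; lra.
  move=> [g [cg g0 Ug] [t /unit_itvE t01 <-]].
  (* The part of [g] up to time [t], reparametrised by the unit interval, ends at [g t]. *)
  exists (fun u => g (t * u + 0)); split.
  - apply: path_affine => // u /unit_itvE u01; rewrite addr0.
    by rewrite mulr_ge0 ?mulr_ile1//; lra.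
  - by rewrite mulr0 add0r.
  - by rewrite mulr1 addr0.
  - move=> u u01; apply: Ug; rewrite addr0.
    by rewrite mulr_ge0 ?mulr_ile1//; lra.
apply: bigcup_connected.
  exists x => g [cg g0 _]; exists 0 => //; apply/unit_itvE; lra.
move=> g [cg _ _]; apply: connected_continuous_connected => //.
exact: segment_connected.
Qed.

Lemma lpc_connected_joined (T : topologicalType) : locally_path_connected T ->
  connected [set: T] -> forall x y : T, joined setT x y.
Proof.
move=> lT cT x y.
apply: (@connected_ind _ setT (joined setT x) x) => //.
- by exact: joined_refl.
- move=> z _ xz; have := lT z setT openT I.
  by apply: filterS => w zw _; exact: joined_trans xz zw.
- move=> z _ nxz; have := lT z setT openT I.
  apply: filterS => w zw _ xw; apply: nxz.
  by apply: joined_trans xw _; exact: joined_sym.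
Qed.

End Paths.
Arguments locally_path_connected R T : clear implicits.
Arguments joined R {T} A x y.

(** * CW complexes are locally path connected *)

Lemma sum_continuous (R : realType) (T : topologicalType) I (r : seq I)
    (f : I -> T -> R) : (forall i, continuous (f i)) ->
  continuous (fun x => \sum_(i <- r) f i x).
Proof.
move=> cf; elim: r => [|i r IH].
  rewrite (_ : (fun _ => _) = fun=> 0); first by move=> x; exact: cvg_cst.
  by apply/funext => x; rewrite big_nil.
rewrite (_ : (fun _ => _) = (fun x => f i x + \sum_(j <- r) f j x)); last first.
  by apply/funext => x; rewrite big_cons.
by move=> x; apply: cvgD; [exact: cf | exact: IH].
Qed.

(** * Compactness and convexity of Euclidean disks *)

Section Disks.
Context {R : realType} (n : nat).
Implicit Types v w : 'rV[R]_n.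

Lemma sqnorm_continuous : continuous (@sqnorm R n).
Proof.
apply: sum_continuous => i v.
rewrite (_ : (fun _ => _) = (fun v : 'rV[R]_n => v ord0 i * v ord0 i)).
  by apply: continuousM; exact: coord_continuous.
by apply/funext => w; rewrite expr2.
Qed.

Lemma disk_closed : closed (@disk R n).
Proof. exact: ((continuous_closedP _).1 sqnorm_continuous _ (@closed_le _ _)). Qed.

Lemma sphere_closed : closed (@sphere R n).
Proof. exact: ((continuous_closedP _).1 sqnorm_continuous _ (@closed_eq _ _)). Qed.

Lemma sqnorm_ge_coord v i : v ord0 i ^+ 2 <= sqnorm v.
Proof.
rewrite /sqnorm (bigD1 i)//= lerDl; apply: sumr_ge0 => j _; exact: sqr_ge0.
Qed.

Lemma disk_compact : compact (@disk R n).
Proof.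
apply: bounded_closed_compact; last exact: disk_closed.
exists 1; split => // M M1 v vD; apply: le_trans (ltW M1).
change (mx_norm v <= 1).
(* A nonzero sup norm is attained at an entry, and the square of that entry is at most
   [sqnorm v]. *)
have [v0|/mx_norm_neq0 [[i j] /= ve]] := eqVneq (mx_norm v) 0.
  by rewrite v0.
rewrite ve (ord1 i) -(@ler_pXn2r _ 2)// ?nnegrE// expr1n real_normK ?num_real//.
exact: le_trans (sqnorm_ge_coord v j) vD.
Qed.

(** Convexity of [sqnorm]: in each coordinate the two sides differ by
    [t * (1 - t) * (a - b) ^+ 2]. *)
Lemma disk_segment v w (t : R) : disk v -> disk w -> 0 <= t <= 1 ->
  disk (v + t *: (w - v)).
Proof.
rewrite /disk/= => vD wD t01.
apply: (@le_trans _ _ ((1 - t) * sqnorm v + t * sqnorm w)).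
  rewrite /sqnorm !mulr_sumr -big_split/=; apply: ler_sum => i _; rewrite !mxE.
  move: (v ord0 i) (w ord0 i) => a b.
  rewrite -subr_ge0.
  have -> : (1 - t) * a ^+ 2 + t * b ^+ 2 - (a + t * (b - a)) ^+ 2 =
    t * (1 - t) * (a - b) ^+ 2 by ring.
  by apply: mulr_ge0; [apply: mulr_ge0; lra | exact: sqr_ge0].
nra.
Qed.

Lemma segment_continuous v w : continuous (fun t : R => v + t *: (w - v)).
Proof.
move=> t.
have cw : {for t, continuous (fun t : R => t *: (w - v))}.
  exact: (@scalel_continuous R 'rV[R]_n (w - v) t).
have cv : {for t, continuous (fun=> v : 'rV[R]_n)} by exact: cvg_cst.
exact: (@continuousD R 'rV[R]_n R _ _ t cv cw).
Qed.

End Disks.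

Section CW.
Context {R : realType} {X : topologicalType} (c : @cw_structure R X).
Notation I := (cw_index c).
Notation D i := (@disk R (@cw_dim R X c i)).
Notation chi i := (@cw_char R X c i).

Lemma cell_image_closed (i : I) (A : set 'rV[R]_(cw_dim i)) :
  A `<=` D i -> closed A -> closed (chi i @` A).
Proof.
move=> AD cA; apply: compact_closed; first exact: (cw_hausdorff c).
apply: continuous_compact.
  exact: continuous_subspaceW (@cw_char_continuous _ _ c i).
exact: subclosed_compact cA (@disk_compact _ _) AD.
Qed.

Lemma cw_closed (A : set X) :
  (forall i : I, closed (D i `&` chi i @^-1` A)) -> closed A.
Proof.
move=> cA; apply: (@cw_weak _ _ c) => i.
rewrite (_ : A `&` _ = chi i @` (D i `&` chi i @^-1` A)).
  by apply: cell_image_closed => // v [].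
by apply/seteqP; split => x; [move=> [Ax [v vD vx]]; exists v; rewrite ?vx//; split;
   rewrite //= vx | move=> [v [vD Ax] <-]; split => //; exists v].
Qed.

Lemma within_closedP (S T : topologicalType) (A : set S) (f : S -> T) :
  closed A -> {within A, continuous f} <->
  (forall C, closed C -> closed (A `&` f @^-1` C)).
Proof.
move=> cA; split => [/continuous_closedP cf C /cf|cf].
  by rewrite -closed_setSI.
by apply/continuous_closedP => C /cf; rewrite closed_setSI.
Qed.

Lemma cw_continuous (T : topologicalType) (f : X -> T) :
  (forall i : I, {within D i, continuous (f \o chi i)}) -> continuous f.
Proof.
move=> cf; apply/continuous_closedP => C cC; apply: cw_closed => i.
exact: (within_closedP _ (@disk_closed _ _)).1 (cf i) C cC.
Qed.

(** The points joined to [x] in [U] pull back to a relatively open set in each disk: near a point of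
    it, straight segments of the convex disk are mapped into [U]. *)
Lemma cw_locally_path_connected : locally_path_connected R X.
Proof.
move=> x U oU Ux.
suff oJ : open [set z | joined R U x z].
  have : nbhs x [set z | joined R U x z].
    by apply: open_nbhs_nbhs; split => //; exact: joined_refl.
  by [].
rewrite -[X in open X]setCK; apply: closed_openC; apply: cw_closed => i.
rewrite -[X in closed X]setCK; apply: open_closedC; rewrite openE => v /= nv.
have [vD|vD] := pselect (D i v); last first.
  have : open (~` D i) by apply: closed_openC; exact: disk_closed.
  by rewrite openE => /(_ v vD); apply: filterS => z zD [].
have jv : joined R U x (chi i v) by apply: contrapT => njv; exact: nv.
have Uv := joined_subset jv.
have /within_contP cchi := @cw_char_continuous _ _ c i.
have := cchi v vD U (open_nbhs_nbhs (conj oU Uv)).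
move=> /nbhs_ballP[e /= e0 vU]; apply/nbhs_ballP; exists e => // w vw [wD]; apply.
apply: joined_trans jv _.
exists (fun t => chi i (v + t *: (w - v))); split.
- have cs : {within `[0, 1]%classic, continuous (fun t : R => v + t *: (w - v))}.
    by apply: continuous_subspaceT; exact: segment_continuous.
  apply: (within_cont_comp cs (@cw_char_continuous _ _ c i)) => t /unit_itvE t01.
  exact: disk_segment.
- by rewrite scale0r addr0.
- by rewrite scale1r addrC subrK.
- move=> t t01; apply: vU; last exact: disk_segment.
  move: vw; rewrite -!ball_normE /ball_/= opprD addrA subrr sub0r normrN normrZ.
  rewrite distrC; apply: le_lt_trans; rewrite ger0_norm; last by lra.
  by rewrite ler_piMl//; lra.
Qed.

End CW.

(** * CW complexes are completely regular *)

Section Urysohn.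
Context {R : realType} {X : topologicalType} (c : @cw_structure R X).
Notation I := (cw_index c).
Notation dim := (@cw_dim R X c).
Notation D i := (@disk R (dim i)).
Notation oD i := (@open_disk R (dim i)).
Notation S i := (@sphere R (dim i)).
Notation chi i := (@cw_char R X c i).

Lemma open_disk_sub n : @open_disk R n `<=` @disk R n.
Proof. by move=> v; rewrite /open_disk /disk /= => /ltW. Qed.

Lemma sphere_sub n : @sphere R n `<=` @disk R n.
Proof. by move=> v; rewrite /sphere /disk /= => ->. Qed.

Lemma disk_split n (v : 'rV[R]_n) : disk v -> open_disk v \/ sphere v.
Proof.
rewrite /disk /open_disk /sphere /= le_eqVlt => /orP[/eqP|]; by [right|left].
Qed.

Lemma cw_point (z : X) :
  exists p : {i : I & 'rV[R]_(dim i)}, open_disk (projT2 p) /\ chi _ (projT2 p) = z.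
Proof.
have : [set: X] z by [].
by rewrite -(cw_cells_cover c) => -[i _ [v vD <-]]; exists (existT _ i v).
Qed.

(** The open cell containing [z], with coordinates of [z] in its disk; both are unique by
    [pt_uniq]. *)
Definition pt (z : X) := projT1 (cid (cw_point z)).
Notation cell z := (projT1 (pt z)).

Lemma pt_disk z : open_disk (projT2 (pt z)).
Proof. by rewrite /pt; case: cid => p []. Qed.

Lemma pt_chi z : chi _ (projT2 (pt z)) = z.
Proof. by rewrite /pt; case: cid => p []. Qed.

Lemma pt_uniq i (v : 'rV[R]_(dim i)) : oD i v -> pt (chi i v) = existT _ i v.
Proof.
move=> vD; have := pt_disk (chi i v); have := pt_chi (chi i v).
case: (pt (chi i v)) => j w /= wv wD.
have ij : i = j.
  apply: (cw_cells_disjoint (c:=c)) => //.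
  by exists (chi i v); split; [exists v | exists w].
subst j; congr existT.
have [[_ inj _] _ _] := @cw_char_homeo _ _ c i.
by apply: inj; rewrite ?inE.
Qed.

Lemma cell_sphere i v : S i v -> (dim (cell (chi i v)) < dim i)%N.
Proof.
move=> vS; have [F [_ dF SF]] := @cw_closure_finite _ _ c i.
have [|j Fj [w wD <-]] := SF (chi i v); first by exists v.
by rewrite (pt_uniq wD); exact: dF.
Qed.

Lemma cell_disk i v : D i v -> (dim (cell (chi i v)) <= dim i)%N.
Proof.
by move=> /disk_split[vD|/cell_sphere/ltnW //]; rewrite (pt_uniq vD).
Qed.

Lemma cell_preimage_closed i (A : set X) : closed A -> closed (D i `&` chi i @^-1` A).
Proof.
exact: ((within_closedP _ (@disk_closed _ _)).1 (@cw_char_continuous _ _ c i)).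
Qed.

(** By closure finiteness the sphere is mapped into finitely many lower cells, so the preimage of a
    closed set comes from a finite union [G] of closed sets. *)
Lemma skeleton_sphere_continuous (u : X -> R) i :
  (forall j, (dim j < dim i)%N -> {within D j, continuous (u \o chi j)}) ->
  {within S i, continuous (u \o chi i)}.
Proof.
move=> cu; have [F [fF dF SF]] := @cw_closure_finite _ _ c i.
apply/(within_closedP _ (@sphere_closed _ _)) => C cC.
pose G := \bigcup_(j in F) (chi j @` (D j `&` (u \o chi j) @^-1` C)).
have cG : closed G.
  apply: (@closed_bigcup X {classic I} F) => // j Fj; apply: cell_image_closed; first by move=> v [].
  exact: ((within_closedP _ (@disk_closed _ _)).1 (cu j (dF j Fj))).
rewrite (_ : _ `&` _ = S i `&` (D i `&` chi i @^-1` G)).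
  by apply: closedI; [exact: sphere_closed | exact: cell_preimage_closed].
apply/seteqP; split => v [vS].
  move=> /= Cv; split => //; split; first exact: sphere_sub.
  have [|j Fj [w wD wv]] := SF (chi i v); first by exists v.
  exists j => //; exists w => //; split; first exact: open_disk_sub.
  by rewrite /= wv.
by move=> [_ [j Fj [w [wD Cw] wv]]]; split => //=; rewrite -wv.
Qed.

Variables (A : set X) (x : X).
Hypotheses (cA : closed A) (nAx : ~ A x).

Definition separates (u : X -> R) : Prop :=
  [/\ u x = 1, forall a, A a -> u a = 0 & forall z, `|u z| <= 1].

(** Tietze extension over one disk, with values prescribed on the boundary sphere and over [A] and
    [x]. The hypotheses stand under the existential so that [ext] is defined for every [u]. *)
Lemma cell_extension (u : X -> R) i : exists g : 'rV[R]_(dim i) -> R,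
  separates u -> {within S i, continuous (u \o chi i)} ->
  [/\ continuous g, forall v, `|g v| <= 1 &
    forall v, D i v -> S i v \/ A (chi i v) \/ chi i v = x -> g v = u (chi i v)].
Proof.
have [[ux uA u1]|] := pselect (separates u); last by exists (fun=> 0).
have [cu|] := pselect {within S i, continuous (u \o chi i)}; last by exists (fun=> 0).
have cx : closed [set x].
  exact/accessible_closed_set1/hausdorff_accessible/(cw_hausdorff c).
pose L := S i `|` ((D i `&` chi i @^-1` A) `|` (D i `&` chi i @^-1` [set x])).
have cDA := @cell_preimage_closed i A cA.
have cDx := @cell_preimage_closed i [set x] cx.
have cL : closed L.
  by apply: closedU; [exact: sphere_closed | exact: closedU].
have cuL : {within L, continuous (u \o chi i)}.
  apply: withinU_continuous => //; [exact: sphere_closed|exact: closedU|].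
  have cst (B : set 'rV[R]_(dim i)) (a : R) : {within B, continuous (fun=> a)}.
    by apply: continuous_subspaceT; exact: cst_continuous.
  apply: withinU_continuous => //.
    by apply: within_cont_eq (cst _ 0) => v [_ Av]; rewrite /= (uA _ Av).
  by apply: within_cont_eq (cst _ 1) => v [_ xv]; rewrite /= xv ux.
have [g [gu cg g1]] := @continuous_bounded_extension _ R
  (@pseudometric_normal R 'rV[R]_(dim i)) _ cL (u \o chi i) 1 ltr01 cuL
  (fun v _ => u1 (chi i v)).
exists g => _ _; split => // v vD vL; rewrite -gu// inE /L.
by case: vL => [?|[?|?]]; [left | right; left | right; right].
Qed.

Definition ext (u : X -> R) i := projT1 (cid (cell_extension u i)).

(* [stage n] is final on the cells of dimension less than [n] and still the indicator function of [x] on the others. *)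
Fixpoint stage (n : nat) (z : X) : R :=
  if n is n'.+1 then
    if dim (cell z) == n' then ext (stage n') (projT2 (pt z)) else stage n' z
  else (z == x)%:R.

Lemma stage_frame n z : dim (cell z) != n -> stage n.+1 z = stage n z.
Proof. by move=> /negbTE /= ->. Qed.

Lemma stage_stable n z : (dim (cell z) < n)%N -> stage n z = stage (dim (cell z)).+1 z.
Proof.
elim: n => // n IH; rewrite ltnS leq_eqVlt => /orP[/eqP ->//|zn].
by rewrite stage_frame ?IH// neq_ltn zn.
Qed.

(** A new stage changes the function only on the cells of one dimension, where the extension keeps
    the values on [A], at [x] and on the boundary sphere; the sphere is mapped into cells already
    settled. *)
Lemma stage_inv n : separates (stage n) /\
  forall i, (dim i < n)%N -> {within D i, continuous (stage n \o chi i)}.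
Proof.
elim: n => [|n [sn IH]].
  split => //; split => [|a Aa|z] /=; first by rewrite eqxx.
    by case: eqP => // ax; move: nAx; rewrite -ax.
  by case: eqP; rewrite ?normr1 ?normr0.
have cS i : dim i = n -> {within S i, continuous (stage n \o chi i)}.
  by move=> di; apply: skeleton_sphere_continuous => j; rewrite di; exact: IH.
have extP i : dim i = n -> [/\ continuous (@ext (stage n) i),
    forall v, `|@ext (stage n) i v| <= 1 &
    forall v, D i v -> S i v \/ A (chi i v) \/ chi i v = x ->
      ext (stage n) v = stage n (chi i v)].
  by move=> di; rewrite /ext; case: cid => g /= /(_ sn (cS i di)).
have [sx sA s1] := sn.
split.
  split => [|a Aa|z] /=.
  - case: eqP => // dx; have [_ _ ->] := extP _ dx; rewrite ?pt_chi//; last by right; right.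
    exact/open_disk_sub/pt_disk.
  - case: eqP => [da|_]; last exact: sA.
    have [_ _ ->] := extP _ da; rewrite ?pt_chi//; [exact: sA| |by right; left].
    exact/open_disk_sub/pt_disk.
  - by case: eqP => [/extP[_ + _]|_]; [exact|exact: s1].
move=> i; rewrite ltnS leq_eqVlt => /orP[/eqP di|di].
  have [cg _ gS] := extP i di.
  apply: (within_cont_eq (f := @ext (stage n) i)); last exact: continuous_subspaceT.
  move=> v vD /=; have [voD|vS] := disk_split vD.
    by rewrite (pt_uniq voD)/= di eqxx.
  (* A boundary point lies in a lower cell, where the old stage is retained, and [ext] agrees with
     it there. *)
  rewrite ifF; last by apply/negbTE; rewrite neq_ltn -{1}di cell_sphere.
  by apply: gS => //; left.
apply: (within_cont_eq (f := stage n \o chi i)); last exact: IH.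
move=> v vD /=; rewrite ifF//; apply/negbTE; rewrite neq_ltn.
by rewrite (leq_ltn_trans (cell_disk vD)).
Qed.

(** Each point is evaluated at the first stage that settles its own cell. On a closed cell of
    dimension [d] the result is the single stage [d.+1], hence continuous. *)
Lemma cw_urysohn : exists2 u : X -> R, continuous u &
  [/\ u x = 1, forall a, A a -> u a = 0 & forall z, `|u z| <= 1].
Proof.
exists (fun z => stage (dim (cell z)).+1 z); last first.
  split=> [|a Aa|z]; [case: (stage_inv (dim (cell x)).+1) => -[+ _ _] _
    | case: (stage_inv (dim (cell a)).+1) => -[_ + _] _
    | case: (stage_inv (dim (cell z)).+1) => -[_ _ +] _]; exact.
apply: (cw_continuous (c := c)) => i.
have [_ /(_ i (ltnSn _)) ci] := stage_inv (dim i).+1.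
apply: within_cont_eq ci => v vD.
by rewrite [LHS]/comp stage_stable// ltnS cell_disk.
Qed.

End Urysohn.

(** * Coverings and liftings *)

Section Coverings.
Context {Y X : topologicalType} (p : Y -> X).

Definition section_over (U : set X) (g : X -> Y) : Prop :=
  {within U, continuous g} /\ forall x, U x -> p (g x) = x.

Hypothesis hp : covering_map p.

(** The inverse of [p] on the sheet through [y]. Later arguments use evenly covered sets only
    through such local sections and [covering_separation]. *)
Lemma covering_section (b : X) : exists U : set X, [/\ open U, U b &
  forall y, U (p y) -> exists2 g, section_over U g & g (p y) = y].
Proof.
have [_ _ /(_ b)[U [oU Ub] [C [_ _ CU homeo]]]] := hp.
exists U; split => // y Uy.
have : (p @^-1` U) y by [].
rewrite CU => -[V CV Vy]; have [[_ _ surj] _ [g cg gK]] := homeo V CV.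
exists g; last by apply: gK; rewrite inE.
split=> // x /surj[v Vv <-]; congr p; by apply: gK; rewrite inE.
Qed.

(* Local injectivity (for [y = y']) together with the separation of distinct
   points of a fibre. *)
Lemma covering_separation (y y' : Y) : p y = p y' ->
  exists V V' : set Y, [/\ nbhs y V, nbhs y' V' &
    forall v v', V v -> V' v' -> p v = p v' -> (v = v' <-> y = y')].
Proof.
move=> yy'; have [_ _ /(_ (p y))[U [oU Ub] [C [Cop tC CU homeo]]]] := hp.
have [V CV Vy] : (\bigcup_(V in C) V) y by rewrite -CU.
have [V' CV' Vy'] : (\bigcup_(V in C) V) y' by rewrite -CU /= -yy'.
exists V, V'; split; [exact: open_nbhs_nbhs (conj (Cop _ CV) Vy)
  |exact: open_nbhs_nbhs (conj (Cop _ CV') Vy')|].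
move=> v v' Vv Vv' vv'.
have VE z : V z -> V' z -> V = V' by move=> Vz Vz'; apply: tC => //; exists z.
have [[_ inj _] _ _] := homeo V CV.
split => [vE|yE].
  have E : V = V' by apply: (VE v) => //; rewrite vE.
  by apply: inj; rewrite ?inE// E.
have E : V = V' by apply: (VE y) => //; rewrite yE.
by apply: inj; rewrite ?inE// E.
Qed.

(** Two lifts of the same map agree on a relatively open set and differ on a relatively open set;
    the equivalence covers both. *)
Lemma lift_near_eq (S : topologicalType) (A : set S) (h h' : S -> Y) a :
  {within A, continuous h} -> {within A, continuous h'} ->
  (forall x, A x -> p (h x) = p (h' x)) -> A a ->
  \forall x \near a, A x -> (h x = h' x <-> h a = h' a).
Proof.
move=> /within_contP ch /within_contP ch' pE Aa.
have [V [V' [nV nV' VV']]] := covering_separation (pE a Aa).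
apply: filterS2 (ch a Aa V nV) (ch' a Aa V' nV') => x Vx Vx' Ax.
by apply: VV'; [exact: Vx|exact: Vx'|exact: pE].
Qed.

Lemma lift_unique (S : topologicalType) (A : set S) (h h' : S -> Y) a :
  connected A ->
  {within A, continuous h} -> {within A, continuous h'} ->
  (forall x, A x -> p (h x) = p (h' x)) -> A a -> h a = h' a ->
  forall x, A x -> h x = h' x.
Proof.
move=> cA ch ch' pE Aa ha; apply: (connected_ind (x0 := a)) => // x Ax hx.
  apply: filterS (lift_near_eq ch ch' pE Ax) => z zx Az.
  exact: (zx Az).2.
by apply: filterS (lift_near_eq ch ch' pE Ax) => z zx Az /(zx Az).1.
Qed.

(** The base point [k] is any point of [A], so that a lift over a second set can be started on its
    overlap with the first. *)
Definition liftable (S : topologicalType) (H : S -> X) (A : set S) : Prop :=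
  forall k y, A k -> p y = H k -> exists h : S -> Y,
    [/\ {within A, continuous h}, forall z, A z -> p (h z) = H z & h k = y].

(** The second lift starts at a point [m] of the overlap with the value of the first; uniqueness on
    the connected overlap makes them agree there, and closedness allows pasting. *)
Lemma liftable_glue (S : topologicalType) (H : S -> X) (A B : set S) :
  closed A -> closed B -> connected (A `&` B) -> A `&` B !=set0 ->
  liftable H A -> liftable H B -> liftable H (A `|` B).
Proof.
suff main (A' B' : set S) k y : closed A' -> closed B' -> connected (A' `&` B') ->
    A' `&` B' !=set0 -> liftable H A' -> liftable H B' -> A' k -> p y = H k ->
    exists h : S -> Y, [/\ {within (A' `|` B'), continuous h},
      forall z, (A' `|` B') z -> p (h z) = H z & h k = y].
  move=> cA cB cAB AB0 gA gB k y [Ak|Bk] yk; first exact: main.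
  by rewrite setUC; apply: main => //; rewrite setIC.
move=> cA cB cAB [m [Am Bm]] gA gB Ak yk.
have [h1 [ch1 ph1 h1k]] := gA k y Ak yk.
have [h2 [ch2 ph2 h2m]] := gB m (h1 m) Bm (ph1 m Am).
have h12 z : A' z -> B' z -> h1 z = h2 z.
  move=> Az Bz; apply: (lift_unique (a := m) cAB) => //.
  - exact: continuous_subspaceW ch1.
  - exact: continuous_subspaceW ch2.
  - by move=> x [Ax Bx]; rewrite ph1// ph2.
pose h z := if pselect (A' z) then h1 z else h2 z.
have hA z : A' z -> h1 z = h z by rewrite /h; case: pselect.
have hB z : B' z -> h2 z = h z.
  by rewrite /h; case: pselect => // Az Bz; rewrite h12.
exists h; split.
- apply: withinU_continuous => //.
    exact: within_cont_eq hA ch1.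
  exact: within_cont_eq hB ch2.
- by move=> z [Az|Bz]; [rewrite -hA ?ph1|rewrite -hB ?ph2].
- by rewrite -hA.
Qed.

Lemma liftable_local (S : topologicalType) (H : S -> X) (A : set S) (s : S) :
  {within A, continuous H} -> A s -> exists2 W, nbhs s W &
    forall B, B `<=` A -> B `<=` W -> liftable H B.
Proof.
move=> /within_contP cH As.
have [U [oU Us secU]] := covering_section (H s).
have nW := cH s As U (open_nbhs_nbhs (conj oU Us)).
exists [set z | A z -> U (H z)]; first exact: nW.
move=> B BA BW k y Bk yk.
have [|g [cg pg] gy] := secU y; first by rewrite yk; apply: BW => //; exact: BA.
exists (g \o H); split.
- apply: (within_cont_comp _ cg); last by move=> x Bx; apply: BW => //; exact: BA.
  by apply: (continuous_subspaceW BA); exact/within_contP.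
- by move=> z Bz; apply: pg; apply: BW => //; exact: BA.
- by rewrite /= -yk.
Qed.

End Coverings.

(** * Lifting maps of the unit square *)

Section Squares.
Context {R : realType}.

(** Cousin's lemma, used in place of a Lebesgue number: the supremum of the [t] with [Q 0 t] has a
    good neighbourhood, so were it below 1, [Q] could be continued past it. *)
Lemma cousin (Q : R -> R -> Prop) :
  (forall x, 0 <= x <= 1 -> exists2 e, 0 < e & forall a b,
     0 <= a -> a <= b -> b <= 1 -> x - e < a -> b < x + e -> Q a b) ->
  (forall a m b, 0 <= a -> a <= m -> m <= b -> b <= 1 ->
     Q a m -> Q m b -> Q a b) ->
  Q 0 1.
Proof.
move=> loc merge; pose S := [set t : R | 0 <= t <= 1 /\ Q 0 t].
have S0 : S 0.
  have [|e e0 eQ] := loc 0; first by lra.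
  by split; [lra | apply: eQ; lra].
have S1 : ubound S 1 by move=> t [? _]; lra.
have hS : has_sup S by split; [exists 0 | exists 1].
have c0 : 0 <= sup S by apply: ub_le_sup => //; exists 1.
have c1 : sup S <= 1 by apply: ge_sup => //; exists 0.
have [|e e0 eQ] := loc (sup S); first by rewrite c0 c1.
have [t [t01 Qt] te] := sup_adherent e0 hS.
have tc : t <= sup S by apply: ub_le_sup; [exists 1|split].
move: (sup S) c0 c1 eQ te tc (fun u (h : S u) => ub_le_sup (ex_intro _ 1 S1) h)
  => c c0 c1 eQ te tc ubc.
have [c1'|c1'] := leP 1 (c + e / 2).
  by apply: (merge 0 t 1) => //; try lra; apply: eQ; lra.
have : c + e / 2 <= c; last by lra.
apply: ubc; split; first by lra.
by apply: (merge 0 t) => //; try lra; apply: eQ; lra.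
Qed.

Definition rect (a b c d : R) : set (R * R) :=
  [set z | a <= z.1 <= b /\ c <= z.2 <= d].

Lemma rect_closed a b c d : closed (rect a b c d).
Proof.
have -> : rect a b c d = (fst @^-1` `[a, b]%classic) `&` (snd @^-1` `[c, d]%classic).
  by apply/seteqP; split => z; rewrite /rect /= !in_itv.
apply: closedI.
  have c1 : continuous (fst : R * R -> R) by move=> z; exact: cvg_fst.
  exact: (continuous_closedP _).1 c1 _ (interval_closed _ _).
have c2 : continuous (snd : R * R -> R) by move=> z; exact: cvg_snd.
exact: (continuous_closedP _).1 c2 _ (interval_closed _ _).
Qed.

(** A nonempty rectangle is the union of the segments issuing from one of its points [z0]. *)
Lemma rect_connected a b c d : connected (rect a b c d).
Proof.
have [->|/set0P[z0 z0r]] := eqVneq (rect a b c d) set0; first exact: connected0.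
have -> : rect a b c d = \bigcup_(z in rect a b c d)
    ((fun t : R => (t * (z.1 - z0.1) + z0.1, t * (z.2 - z0.2) + z0.2)) @` `[0, 1]%classic).
  apply/seteqP; split => [z zr|z].
    by exists z => //; exists 1; [apply/unit_itvE; lra
      | rewrite !mul1r !subrK; case: z {zr}].
  move=> [w [w1 w2] [t /unit_itvE t01 <-]]; case: z0r => z1 z2; split => /=; nra.
apply: bigcup_connected.
  exists z0 => z _; exists (0 : R); first by apply/unit_itvE; lra.
  by rewrite !mul0r !add0r; case: (z0).
move=> z _; apply: connected_continuous_connected; first exact: segment_connected.
apply: continuous_subspaceT => t.
have c1 := @affine_continuous R (z.1 - z0.1) z0.1 t.
have c2 := @affine_continuous R (z.2 - z0.2) z0.2 t.
under eq_fun do rewrite mulrC [X in (_, X + _)]mulrC.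
exact: (cvg_pair c1 c2).
Qed.

End Squares.

Section SquareLifting.
Context {R : realType} {Y X : topologicalType} (p : Y -> X).
Hypothesis hp : covering_map p.

(** Two nested uses of [cousin]: the outer one stacks thin horizontal strips, the inner one builds
    such a strip out of small rectangles, which lift by [liftable_local]. *)
Lemma square_liftable (H : R * R -> X) :
  {within rect 0 1 0 1, continuous H} -> liftable p H (rect 0 1 0 1).
Proof.
move=> cH; apply: (@cousin R (fun c d => liftable p H (rect 0 1 c d))); last first.
  move=> a m b a0 am mb b1 Qam Qmb.
  have -> : rect 0 1 a b = rect 0 1 a m `|` rect 0 1 m b.
    apply/seteqP; split => -[x y]; rewrite /rect /=; last by case; lra.
    by case: (leP y m) => ?; [left|right]; lra.
  have rI : rect 0 1 a m `&` rect 0 1 m b = rect 0 1 m m.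
    by apply/seteqP; split => -[x y]; rewrite /rect /=; lra.
  apply: liftable_glue => //; rewrite ?rI; try exact: rect_closed.
  - exact: rect_connected.
  - by exists (0, m); rewrite /rect /=; lra.
move=> s s01.
suff [e e0 eQ] : exists2 e, 0 < e & forall c d, 0 <= c -> c <= d -> d <= 1 ->
    s - e < c -> d < s + e -> liftable p H (rect 0 1 c d) by exists e.
(* The thickness [e] may depend on the interval from [a] to [b]; merging two intervals takes the
   smaller one. *)
pose Q a b := exists2 e, 0 < e & forall c d, 0 <= c -> c <= d -> d <= 1 ->
    s - e < c -> d < s + e -> liftable p H (rect a b c d).
apply: (@cousin R Q); last first.
  move=> a m b a0 am mb b1 [e e0 eQ] [e' e0' eQ'].
  exists (Num.min e e'); first by rewrite lt_min e0.
  move=> c d c0 cd d1; rewrite ltrBlDr -ltrBlDl -ltrBlDl !lt_min => /andP[? ?] /andP[? ?].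
  have -> : rect a b c d = rect a m c d `|` rect m b c d.
    apply/seteqP; split => -[x y]; rewrite /rect /=; last by case; lra.
    by case: (leP x m) => ?; [left|right]; lra.
  have rI : rect a m c d `&` rect m b c d = rect m m c d.
    by apply/seteqP; split => -[x y]; rewrite /rect /=; lra.
  apply: liftable_glue => //; rewrite ?rI; try exact: rect_closed.
  - exact: rect_connected.
  - by exists (m, c); rewrite /rect /=; lra.
  - by apply: eQ => //; lra.
  - by apply: eQ' => //; lra.
move=> t t01.
have [|W nW WL] := @liftable_local _ _ p hp _ H (rect 0 1 0 1) (t, s) cH.
  by rewrite /rect /=.
have /nbhs_ballP[e /= e0 eW] := nW.
exists e => // a b a0 ab b1 ta bt; exists e => // c d c0 cd d1 sc ds.
apply: WL => -[x y]; rewrite /rect /= => -[xab ycd]; first by split; lra.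
by apply: eW; split; rewrite /ball/= ltr_distl/=; lra.
Qed.

(** A path is a map of the square that is constant in the second coordinate; the bottom edge of its
    lift is the wanted path. *)
Lemma path_lift (g : R -> X) y : path_on g -> p y = g 0 ->
  exists h : R -> Y, [/\ path_on h, forall t, 0 <= t <= 1 -> p (h t) = g t & h 0 = y].
Proof.
move=> cg yg.
have cH : {within rect 0 1 0 1, continuous (fun z : R * R => g z.1)}.
  have c1 : {within rect 0 1 0 1, continuous (fst : R * R -> R)}.
    by apply: continuous_subspaceT => z; exact: cvg_fst.
  by apply: (within_cont_comp c1 cg) => z [/unit_itvE].
have [|h [ch ph h0]] := square_liftable cH (k := (0, 0)) _ yg.
  by rewrite /rect /=; lra.
exists (fun t => h (t, 0)); split => //; last first.
  by move=> t t01; rewrite ph// /rect/=; lra.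
have c0 : {within `[0, 1]%classic, continuous (fun t : R => (t, 0 : R))}.
  by apply: continuous_subspaceT => t; apply: (cvg_pair cvg_id (cvg_cst _)).
by apply: (within_cont_comp c0 ch) => t /unit_itvE t01; rewrite /rect /=; lra.
Qed.

Lemma path_lift_unique (h h' : R -> Y) : path_on h -> path_on h' ->
  (forall t, 0 <= t <= 1 -> p (h t) = p (h' t)) -> h 0 = h' 0 ->
  forall t, 0 <= t <= 1 -> h t = h' t.
Proof.
move=> ch ch' pE h0 t /unit_itvE t01.
apply: (lift_unique hp (@segment_connected R 0 1) ch ch' _ _ h0) => //.
by apply/unit_itvE; lra.
Qed.

End SquareLifting.

(** * The lifting criterion for simply connected spaces *)

Section LiftingCriterion.
Context {R : realType} {E Y X : topologicalType} (p : Y -> X) (q : E -> X).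
Hypothesis hp : covering_map p.
Hypothesis scE : @simply_connected R E.
Hypothesis lE : locally_path_connected R E.
Hypothesis cq : continuous q.

(** Lift a null homotopy of [g] to the square. The bottom edge is [h], the left and top edges are
    constantly [h 0] and the right edge is constantly [h 1]; the corner [(1, 1)] compares them. *)
Lemma loop_lift_closed (g : R -> E) (h : R -> Y) : path_on g -> g 0 = g 1 ->
  path_on h -> (forall t, 0 <= t <= 1 -> p (h t) = q (g t)) -> h 0 = h 1.
Proof.
move=> cg g01 ch hg; have [_ /(_ g cg g01)[H [cH Ht Hs]]] := scE.
have sqE : `[0, 1]%classic `*` `[0, 1]%classic = rect 0 1 0 1 :> set (R * R).
  by apply/seteqP; split => z; rewrite /rect /= !in_itv.
rewrite sqE in cH.
have i01 (t : R) : 0 <= t <= 1 -> t \in `[0, 1] by rewrite in_itv.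
have cqH : {within rect 0 1 0 1, continuous (q \o H)}.
  have cqT : {within [set: E], continuous q} by exact: continuous_subspaceT.
  exact: (within_cont_comp cH cqT).
have o0 : (0 : R) \in `[0, 1] by apply: i01; lra.
have o1 : (1 : R) \in `[0, 1] by apply: i01; lra.
have [||L [cL pL L0]] := square_liftable hp cqH (k := (0, 0)) (y := h 0).
- by rewrite /rect /=; lra.
- by rewrite hg /=; [rewrite (Ht 0 o0).1|lra].
have edge (f : R -> R * R) : continuous f ->
    (forall t, 0 <= t <= 1 -> rect 0 1 0 1 (f t)) -> path_on (L \o f).
  move=> cf fr; have cf1 : {within `[0, 1]%classic, continuous f}.
    exact: continuous_subspaceT.
  by apply: (within_cont_comp cf1 cL) => t /unit_itvE /fr.
have cst_path : path_on (fun _ : R => h 0).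
  by apply: continuous_subspaceT; exact: cst_continuous.
have cfst a : continuous (fun t : R => (t, a : R)).
  by move=> t; apply: (cvg_pair cvg_id (cvg_cst _)).
have csnd a : continuous (fun t : R => (a : R, t)).
  by move=> t; apply: (cvg_pair (cvg_cst _) cvg_id).
have bottom t : 0 <= t <= 1 -> L (t, 0) = h t.
  apply: (path_lift_unique hp (h := L \o (fun t => (t, 0)))) => //.
    by apply: edge => // u u01; rewrite /rect /=; lra.
  move=> u u01 /=; rewrite pL; last by rewrite /rect /=; lra.
  by rewrite hg//= (Ht u (i01 u u01)).1.
have left_edge t : 0 <= t <= 1 -> L (0, t) = h 0.
  apply: (path_lift_unique hp (h := L \o (fun t => (0, t))) (h' := fun=> h 0)) => //.
    by apply: edge => // u u01; rewrite /rect /=; lra.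
  move=> u u01 /=; rewrite pL; last by rewrite /rect /=; lra.
  by rewrite hg/= ?(Hs u (i01 u u01)).1//; lra.
have top t : 0 <= t <= 1 -> L (t, 1) = h 0.
  apply: (path_lift_unique hp (h := L \o (fun t => (t, 1))) (h' := fun=> h 0)) => //.
  - by apply: edge => // u u01; rewrite /rect /=; lra.
  - move=> u u01 /=; rewrite pL; last by rewrite /rect /=; lra.
    by rewrite hg/= ?(Ht u (i01 u u01)).2//; lra.
  - by apply: left_edge; lra.
have right_edge t : 0 <= t <= 1 -> L (1, t) = h 1.
  apply: (path_lift_unique hp (h := L \o (fun t => (1, t))) (h' := fun=> h 1)) => //.
  - by apply: edge => // u u01; rewrite /rect /=; lra.
  - by apply: continuous_subspaceT; exact: cst_continuous.
  - move=> u u01 /=; rewrite pL; last by rewrite /rect /=; lra.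
    by rewrite hg; [rewrite /= (Hs u (i01 u u01)).2 g01 | lra].
  - by apply: bottom; lra.
by rewrite -(right_edge 1) ?(top 1)//; lra.
Qed.

Variables (e0 : E) (y0 : Y).
Hypothesis y0e0 : p y0 = q e0.

(** The graph of the lift of [q], before it is known to be a function: [y] is where the lift from
    [y0] of the image of a path from [e0] to [e] ends. *)
Definition transports (e : E) (y : Y) : Prop := exists (g : R -> E) (h : R -> Y),
  [/\ path_on g, path_on h, forall t, 0 <= t <= 1 -> p (h t) = q (g t) &
    [/\ g 0 = e0, h 0 = y0, g 1 = e & h 1 = y]].

Lemma transports_total e : exists y, transports e y.
Proof.
have [[_ pc] _] := scE; have [g [cg g0 g1]] := pc e0 e.
have cqg : path_on (q \o g).
  have cqT : {within [set: E], continuous q} by exact: continuous_subspaceT.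
  exact: (within_cont_comp cg cqT).
have [|h [ch ph h0]] := path_lift hp (y := y0) cqg; first by rewrite /= g0.
by exists (h 1), g, h.
Qed.

Lemma transports_unique e y y' : transports e y -> transports e y' -> y = y'.
Proof.
move=> [g [h [cg ch hg [g0 h0 g1 <-]]]] [g' [h' [cg' ch' hg' [g0' h0' g1' <-]]]].
(* Lift the inverse of [h'] starting at [h 1]: the lift of the loop closes up, so it ends at [y0], and uniqueness of lifts makes it the inverse of [h']. *)
have cr' := path_rev cg'.
have cqr : path_on (fun t => q (g' (-1 * t + 1))).
  have cqT : {within [set: E], continuous q} by exact: continuous_subspaceT.
  exact: (within_cont_comp cr' cqT).
have [|k [ck pk k0]] := path_lift hp (y := h 1) cqr.
  by rewrite hg ?mulr0 ?add0r ?g1 ?g1'//; lra.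
have hk : path_cat h k 0 = path_cat h k 1.
  apply: (loop_lift_closed (g := path_cat g (fun t => g' (-1 * t + 1)))).
  - by apply: path_catP => //; rewrite mulr0 add0r g1 g1'.
  - by rewrite path_cat0 path_cat1 mulr1 addNr g0 g0'.
  - exact: path_catP.
  - move=> t t01; rewrite /path_cat; case: leP => ?; [rewrite hg|rewrite pk] => //; lra.
rewrite path_cat0 path_cat1 h0 in hk.
have kE := path_lift_unique hp (path_rev ck) ch'.
have : k (-1 * 1 + 1) = h' 1.
  apply: kE; last by lra.
    move=> t t01; rewrite pk ?hg'//; last by lra.
    by congr (q (g' _)); lra.
  by rewrite mulr0 add0r -hk h0'.
by rewrite mulr1 addNr k0.
Qed.

(** Continuity at [e]: nearby points are reached by prolonging a path to [e] with a short one inside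
    an evenly covered set, which lifts through a local section [s]. Hence the lift is [s \o q] near
    [e]. *)
Lemma covering_lift : exists f : E -> Y,
  [/\ continuous f, forall e, p (f e) = q e & f e0 = y0].
Proof.
pose f e := projT1 (cid (transports_total e)).
have fP e : transports e (f e) by rewrite /f; case: cid.
have fE e y : transports e y -> f e = y by exact: transports_unique.
have pf e : p (f e) = q e.
  have [g [h [_ _ hg [_ _ <- <-]]]] := fP e; apply: hg; lra.
exists f; split => //; last first.
  apply: fE; exists (fun=> e0), (fun=> y0); split => //.
  - by apply: continuous_subspaceT; exact: cst_continuous.
  - by apply: continuous_subspaceT; exact: cst_continuous.
move=> e W nW.
have [U [oU Ue secU]] := covering_section hp (q e).
have [|s [cs ps] sfe] := secU (f e); first by rewrite pf.
rewrite pf in sfe.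
have nWs : nbhs (q e) (s @^-1` W).
  by apply: (within_cont_open oU cs Ue); rewrite sfe.
have nWU : nbhs e (q @^-1` (s @^-1` W `&` U)).
  by apply: cq; apply: filterI => //; exact: open_nbhs_nbhs.
have oI : open (q @^-1` (s @^-1` W `&` U))^° by exact: open_interior.
have := lE oI nWU; apply: filterS => e' [g [cg g0 g1 gU]].
have {}gU t : 0 <= t <= 1 -> (s @^-1` W `&` U) (q (g t)).
  by move=> /gU /interior_subset.
have g1U := gU 1; rewrite g1 in g1U.
suff fe' : f e' = s (q e') by rewrite /preimage /= fe'; apply: (g1U _).1; lra.
apply: fE; have [g' [h' [cg' ch' hg' [g0' h0' g1' h1']]]] := fP e.
have csg : path_on (fun t => s (q (g t))).
  have cqT : {within [set: E], continuous q} by exact: continuous_subspaceT.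
  have cqg : path_on (q \o g) by exact: (within_cont_comp cg cqT).
  by apply: (within_cont_comp cqg cs) => t /unit_itvE /gU[].
exists (path_cat g' g), (path_cat h' (fun t => s (q (g t)))); split.
- by apply: path_catP => //; rewrite g1'.
- by apply: path_catP => //; rewrite h1' g0.
- move=> t t01; rewrite /path_cat; case: leP => ?; first by apply: hg'; lra.
  by apply: ps; apply: (gU _ _).2; lra.
- by split; rewrite ?path_cat0 ?path_cat1 ?g1.
Qed.

End LiftingCriterion.

(** * Coverings of [X] factoring through [Y] *)

Section SectionImages.
Context {Y X : topologicalType} (p : Y -> X) (U : set X) (s : X -> Y).
Hypothesis hp : covering_map p.
Hypotheses (oU : open U) (sU : section_over p U s).

(** Both [s \o p] and the identity lift [p] over the preimage of [U], and they agree at [y]. *)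
Lemma section_near y : U (p y) -> s (p y) = y -> \forall v \near y, s (p v) = v.
Proof.
move=> Uy sy; have [cp _ _] := hp; have [cs ps] := sU.
have oW : open (p @^-1` U) by apply: open_comp => // z _; exact: cp.
have csp : {within p @^-1` U, continuous (s \o p)}.
  by apply: (within_cont_comp _ cs) => //; exact: continuous_subspaceT.
have cid : {within p @^-1` U, continuous (@idfun Y)}.
  by apply: continuous_subspaceT => z; exact: cvg_id.
have := lift_near_eq hp csp cid (fun z Uz => ps (p z) Uz) Uy.
by apply: filterS2 (open_nbhs_nbhs (conj oW Uy)) => v Uv /(_ Uv)/=; tauto.
Qed.

(** The sheet traced out by [s], written as a set of fixed points so that its openness is
    [section_near]. *)
Definition section_image : set Y := [set y | U (p y) /\ s (p y) = y].

Lemma section_image_open : open section_image.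
Proof.
have [cp _ _] := hp; rewrite openE => y [Uy sy].
have oW : open (p @^-1` U) by apply: open_comp => // z _; exact: cp.
by apply: filterS2 (open_nbhs_nbhs (conj oW Uy)) (section_near Uy sy) => v.
Qed.

End SectionImages.

(** Short paths in [X] are carried up by a local section. *)
Lemma covering_locally_path_connected (R : realType) (Y X : topologicalType)
  (p : Y -> X) : covering_map p ->
  locally_path_connected R X -> locally_path_connected R Y.
Proof.
move=> hp lX y O oO Oy; have [cp _ _] := hp.
have [U [oU Uy secU]] := covering_section hp (p y).
have [s sU sy] := secU y Uy; have [cs ps] := sU.
have nI : nbhs (p y) (s @^-1` O `&` U).
  apply: filterI; last exact: open_nbhs_nbhs.
  by apply: (within_cont_open oU cs Uy); rewrite sy; exact: open_nbhs_nbhs.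
have oI : open (s @^-1` O `&` U)^° by exact: open_interior.
have nJ : nbhs y (p @^-1` (joined R (s @^-1` O `&` U)^° (p y))).
  exact: cp y _ (lX _ _ oI nI).
have nS := section_near hp oU sU Uy sy.
apply: filterS2 nJ nS => v [g [cg g0 g1 gI]] sv; exists (s \o g).
have {}gI t : 0 <= t <= 1 -> (s @^-1` O `&` U) (g t).
  by move=> /gI /interior_subset.
split => /=; rewrite ?g0 ?g1//.
- by apply: (within_cont_comp cg cs) => t /unit_itvE /gI[].
- by move=> t /gI[].
Qed.

Lemma simply_connected_connected (R : realType) (E : topologicalType) :
  @simply_connected R E -> connected [set: E].
Proof.
move=> [[[e _] pc] _].
have -> : [set: E] = [set z | joined R setT e z].
  apply/seteqP; split => // z _; have [g [cg g0 g1]] := pc e z.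
  by exists g.
exact: joined_connected.
Qed.

Section IntermediateCovering.
Context {R : realType} {E Y X : topologicalType}.
Variables (p : Y -> X) (q : E -> X) (q' : E -> Y).
Hypotheses (hp : covering_map p) (hq : covering_map q).
Hypothesis lX : locally_path_connected R X.
Hypotheses (cq' : continuous q') (pq' : forall e, p (q' e) = q e).

(** A path in [Y] from [q' e0] to [y] projects to [X] and lifts to [E]; the image of that lift under
    [q'] has the same start and the same projection, so it ends at [y]. *)
Lemma intermediate_covering_surj (e0 : E) :
  locally_path_connected R Y -> connected [set: Y] -> range q' = [set: Y].
Proof.
move=> lY cY; apply/seteqP; split => // y _.
have [g [cg g0 g1 _]] := lpc_connected_joined lY cY (q' e0) y.
have [cp _ _] := hp.
have cpg : path_on (p \o g).
  have cpT : {within [set: Y], continuous p} by exact: continuous_subspaceT.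
  exact: (within_cont_comp cg cpT).
have [|k [ck qk k0]] := path_lift hq (y := e0) cpg; first by rewrite /= g0.
have cqk : path_on (q' \o k).
  have cqT : {within [set: E], continuous q'} by exact: continuous_subspaceT.
  exact: (within_cont_comp ck cqT).
exists (k 1) => //; rewrite -g1.
apply: (path_lift_unique hp cqk cg) => [t t01||] /=; last by lra.
  by rewrite pq' qk.
by rewrite k0 g0.
Qed.

(** Let [N] be a path component of an open set with local sections of both [p] and [q]. Over the
    sheet of [s] on [N], the sheets of [q'] are those of the sections [g] of [q] with [q' \o g = s]
    on [N]; connectedness of [N] makes them disjoint and exhaustive. *)
Lemma intermediate_covering : range q' = [set: Y] -> covering_map q'.
Proof.
move=> surj; split => // y; have [cp _ _] := hp; have [cq _ _] := hq.
have [Up [oUp Upy secp]] := covering_section hp (p y).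
have [Uq [oUq Uqy secq]] := covering_section hq (p y).
pose N := [set z | joined R (Up `&` Uq) (p y) z].
have oN : open N by apply: joined_open => //; exact: openI.
have Ny : N (p y) by apply: joined_refl.
have cN : connected N by apply: joined_connected.
have NU : N `<=` Up `&` Uq by exact: joined_subset.
have [s [cs ps] sy] := secp y Upy.
have sN : section_over p N s.
  split => [|x /NU[Ux _]]; last exact: ps.
  by apply: continuous_subspaceW cs => x /NU[].
exists (section_image p N s); first by split; [exact: section_image_open|split].
pose good g := section_over q N g /\ forall x, N x -> q' (g x) = s x.
exists [set W | exists2 g, good g & W = section_image q N g]; split.
- by move=> _ [g [gN _] ->]; exact: section_image_open.
- move=> W W' [g [[cg qg] _] ->] [g' [[cg' qg'] _] ->] [e [[Ne ge] [_ ge']]].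
  have gg' x : N x -> g x = g' x.
    apply: (lift_unique hq cN cg cg' _ Ne); last by rewrite ge ge'.
    by move=> z Nz; rewrite qg ?qg'.
  apply/seteqP; split => z [Nz gz]; split => //; [rewrite -gg'//|rewrite gg'//].
- apply/seteqP; split => [e [] /=|e [_ [g [gN gs] ->] [Ne ge]]]; last first.
    by rewrite /= /section_image /= pq'; split => //; rewrite -gs// ge.
  rewrite pq' => Ne se.
  have [|g [cg qg] ge] := secq e; first by have [] := NU _ Ne.
  have gN : section_over q N g.
    split => [|x /NU[_ Ux]]; last exact: qg.
    by apply: continuous_subspaceW cg => x /NU[].
  exists (section_image q N g) => //; exists g => //; split => //.
  have cqg : {within N, continuous (q' \o g)}.
    have cqT : {within [set: E], continuous q'} by exact: continuous_subspaceT.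
    exact: (within_cont_comp gN.1 cqT).
  apply: (lift_unique hp cN cqg sN.1 _ Ne) => /=; last by rewrite ge se.
  by move=> x Nx; rewrite pq' gN.2// sN.2.
- move=> _ [g [[cg qg] gs] ->]; split.
  + split.
    * move=> e [Ne ge]; rewrite /section_image /= pq'.
      by split => //; rewrite -gs// ge.
    * move=> e e'; rewrite !inE => -[_ ge] [_ ge'] ee'.
      by rewrite -ge -ge' -!pq' ee'.
    * move=> v [Nv sv]; exists (g (p v)); last by rewrite gs.
      by split; rewrite qg.
  + exact: continuous_subspaceT.
  + exists (g \o p).
      have cpT : {within section_image p N s, continuous p} by exact: continuous_subspaceT.
      by apply: (within_cont_comp cpT cg) => v [].
    by move=> e; rewrite inE => -[_ ge]; rewrite /= pq'.
Qed.

End IntermediateCovering.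

(** * Translating the fibres of the universal covering *)

Section FibreTranslation.
Context {R : realType} {E Y X : topologicalType}.
Variables (p : Y -> X) (q : E -> X) (q' : E -> Y) (e0 : E).
Hypotheses (hp : covering_map p) (hq : covering_map q).
Hypotheses (scE : @simply_connected R E) (lE : locally_path_connected R E).
Hypotheses (cq' : continuous q') (pq' : forall e, p (q' e) = q e).
Hypothesis surj : range q' = [set: Y].

Let cE : connected [set: E] := simply_connected_connected scE.

Let lift_eq (h h' : E -> Y) e : continuous h -> continuous h' ->
  (forall x, p (h x) = p (h' x)) -> h e = h' e -> h = h'.
Proof.
move=> ch ch' pE he; apply/funext => x.
apply: (lift_unique hp cE _ _ _ _ he) => //; exact: continuous_subspaceT.
Qed.

(** The lift of [q] along itself that sends [e0] to a point over [y]. For [y] outside the fibre any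
    map will do, so that [deck] is total. *)
Lemma deck_map (y : Y) : exists d : E -> E, p y = q e0 ->
  [/\ continuous d, forall e, q (d e) = q e & q' (d e0) = y].
Proof.
have [y0|] := pselect (p y = q e0); last by exists id.
have : [set: Y] y by [].
rewrite -surj => -[c _ cy].
have [cq _ _] := hq.
have [|d [cd qd d0]] := covering_lift hq scE lE cq (e0 := e0) (y0 := c).
  by rewrite -pq' cy.
by exists d; rewrite d0.
Qed.

Definition deck (y : Y) : E -> E := projT1 (cid (deck_map y)).

Lemma deckP y : p y = q e0 ->
  [/\ continuous (deck y), forall e, q (deck y e) = q e & q' (deck y e0) = y].
Proof. by rewrite /deck; case: cid. Qed.

(** The copy of [E] through [(y, e)] is the graph of the lift [L] of [q] with [L e = y], and its
    index is [L e0]. The lifts [L] and [q' \o deck (L e0)] have the same value at [e0], so they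
    coincide. *)
Lemma sheet_exists (y : Y) (e : E) : exists f : Y, p y = q e ->
  p f = q e0 /\ q' (deck f e) = y.
Proof.
have [ye|] := pselect (p y = q e); last by exists y.
have [cq _ _] := hq.
have [L [cL pL Le]] := covering_lift hp scE lE cq ye.
exists (L e0) => _; split; first exact: pL.
have [cd qd d0] := deckP (pL e0).
rewrite -Le -[LHS]/((q' \o deck (L e0)) e); congr (_ e).
apply: (lift_eq (e := e0)) => // [x|x].
  by apply: continuous_comp; [exact: cd|exact: cq'].
by rewrite /= pq' qd pL.
Qed.

Definition sheet (y : Y) (e : E) : Y := projT1 (cid (sheet_exists y e)).

(* The pullback [{(y, e) | p y = q e}] is a disjoint union of copies of [E], indexed by the fibre of [p] over [q e0]; [translate] sends each copy to [E] over [Y]. *)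
Definition translate (y : Y) (e : E) : E := deck (sheet y e) e.

Lemma sheetP y e : p y = q e -> p (sheet y e) = q e0 /\ q' (translate y e) = y.
Proof. by rewrite /translate /sheet; case: cid. Qed.

(** Nearby pairs [(s (q x), x)] lie on the same copy of [E], so near [e] the map is one fixed deck
    map. *)
Lemma translate_continuous (U : set X) (s : X -> Y) e : open U ->
  section_over p U s -> U (q e) ->
  {for e, continuous (fun e => translate (s (q e)) e)}.
Proof.
move=> oU [cs ps] Ue; have [cq _ _] := hq.
have [pf te] := sheetP (ps _ Ue); set f := sheet _ e in pf.
have [cd qd d0] := deckP pf.
have cqd : continuous (q' \o deck f).
  by move=> x; apply: continuous_comp; [exact: cd|exact: cq'].
have oV : open (q @^-1` U) by apply: open_comp => // z _; exact: cq.
have cqT : {within q @^-1` U, continuous q} by exact: continuous_subspaceT.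
have csq : {within q @^-1` U, continuous (s \o q)} by exact: (within_cont_comp cqT cs).
have cqd' : {within q @^-1` U, continuous (q' \o deck f)} by exact: continuous_subspaceT.
have pE x : (q @^-1` U) x -> p (q' (deck f x)) = p (s (q x)).
  by move=> Ux; rewrite pq' qd ps.
have near_translate : \forall x \near e, deck f x = translate (s (q x)) x.
  apply: filterS2 (open_nbhs_nbhs (conj oV Ue)) (lift_near_eq hp cqd' csq pE Ue).
  move=> x Ux /(_ Ux)[_ /(_ te) /= qdx].
  have [pf' te'] := sheetP (ps _ Ux); set f' := sheet _ x in pf' te' *.
  have [cd' qd' d0'] := deckP pf'.
  (* The lifts [q' \o deck f] and [q' \o deck f'] agree at [x], hence at [e0], where their values
     are the indices. *)
  suff ff' : f = f' by rewrite /translate -/f' ff'.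
  rewrite -d0 -d0' -[LHS]/((q' \o deck f) e0) -[RHS]/((q' \o deck f') e0).
  congr (_ e0); apply: (lift_eq (e := x)) => //.
  - by move=> z; apply: continuous_comp; [exact: cd'|exact: cq'].
  - by move=> z; rewrite /= !pq' qd qd'.
  - by rewrite /= qdx -te'.
move=> W /=; rewrite -(nbhs_singleton near_translate) => /(cd e) nW.
have {}nW : \forall x \near e, W (deck f x) by exact: nW.
by apply: filterS2 nW near_translate => x Wx dx; rewrite /preimage /= -dx.
Qed.

End FibreTranslation.

(** * Finitely supported measures *)

Section FiniteMeasures.
Context {R : realType}.
Implicit Types Z : topologicalType.

Definition fin_integral Z (mu : @fin_measure R Z) (g : Z -> R) : R :=
  \sum_(z <- supp mu) weight mu z * g z.

(** The weak topology is initial for a map into a pointwise function space, so continuity is tested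
    on each evaluation. *)
Lemma fin_integral_continuousP (T : topologicalType) Z (m : T -> @fin_measure R Z) :
  continuous m <->
  (forall g : Z -> R, bounded_continuous g -> continuous (fun t => fin_integral (m t) g)).
Proof.
split=> [cm g bg t|cm].
  pose G : @bounded_continuous R Z := exist _ g (mem_set bg).
  have cI := @initial_continuous _ _ (@integral_against R Z).
  have cp := @proj_continuous _ (fun=> R : topologicalType) G.
  have h1 : {for t, continuous (@integral_against R Z \o m)}.
    by apply: continuous_comp; [exact: cm|exact: cI].
  exact: (continuous_comp h1 (cp _)).
apply: continuous_comp_initial => t; apply/cvg_sup => G.
apply/cvg_image; first by rewrite eqEsubset; split => // v _; exists (cst v).
move=> W nW.
have := cm _ (set_valP G) t W nW.
move=> nW'; exists ((fun f => f G) @^-1` W); first exact: nW'.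
by rewrite eqEsubset; split => [_ [f Wf <-]//|v Wv]; exists (fun=> v).
Qed.

Lemma weight_supp Z (mu : @fin_measure R Z) z : (z \in supp mu) = (weight mu z != 0).
Proof. by rewrite /supp /weight mem_finsupp. Qed.

(** Pushforward of a measure. Weights are not assumed nonnegative and may cancel over a point, so
    [push_supp] is only an inclusion. *)
Definition push Z Z' (f : Z -> Z') (mu : @fin_measure R Z) : @fin_measure R Z' :=
  [fsfun z in [fset f x | x in supp mu]%fset =>
     \sum_(x <- supp mu | f x == z) weight mu x | 0].

Lemma push_weight Z Z' (f : Z -> Z') mu z :
  weight (push f mu) z = \sum_(x <- supp mu | f x == z) weight mu x.
Proof.
rewrite /weight /push fsfun_fun; case: ifPn => // /imfsetP nz.
rewrite big_seq_cond big1// => x /andP[xs /eqP fx].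
by case: nz; exists x.
Qed.

Lemma push_supp Z Z' (f : Z -> Z') mu :
  {subset supp (push f mu) <= [fset f x | x in supp mu]%fset}.
Proof.
move=> z; rewrite weight_supp push_weight; apply: contraR => /imfsetP nz.
rewrite big_seq_cond big1// => x /andP[xs /eqP fx].
by case: nz; exists x.
Qed.

Lemma fin_integral_push Z Z' (f : Z -> Z') mu g :
  fin_integral (push f mu) g = fin_integral mu (g \o f).
Proof.
rewrite /fin_integral.
(* Extend the sum to the whole image of the support: the added points have weight 0. *)
have -> : \sum_(z <- supp (push f mu)) weight (push f mu) z * g z =
    \sum_(z <- [fset f x | x in supp mu]%fset) weight (push f mu) z * g z.
  rewrite [RHS](bigID (mem (supp (push f mu))))/= [X in _ + X]big1 ?addr0; last first.
    by move=> z; rewrite weight_supp negbK => /eqP ->; rewrite mul0r.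
  rewrite -[RHS]big_filter; apply: perm_big; apply: uniq_perm; rewrite ?filter_uniq ?fset_uniq//.
  move=> z; rewrite mem_filter.
  by apply/idP/andP => [zs|[]//]; split => //; exact: push_supp.
under eq_bigr do rewrite push_weight mulr_suml.
rewrite (exchange_big_dep xpredT)//= big_seq [RHS]big_seq.
apply: eq_bigr => x xs.
rewrite big_mkcond (bigD1_seq (f x)) ?fset_uniq//=; last exact: in_imfset.
rewrite eqxx big1 ?addr0// => z zx; rewrite eq_sym.
by rewrite (negbTE zx).
Qed.

Lemma push_Bn Z Z' (f : Z -> Z') n mu : Bn n mu -> Bn n (push f mu).
Proof.
move=> [mun mu0 mu1]; split.
- apply: leq_trans mun.
  have sub : (supp (push f mu) `<=` [fset f x | x in supp mu])%fset.
    by apply/fsubsetP; exact: push_supp.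
  exact: leq_trans (fsubset_leq_card sub) (leq_imfset_card _ _ _).
- by move=> z; rewrite push_weight; apply: sumr_ge0.
(* The total mass is the integral of the constant 1. *)
- have := @fin_integral_push _ _ f mu (fun=> 1); rewrite /fin_integral /=.
  under eq_bigr do rewrite mulr1.
  by under [X in _ = X -> _]eq_bigr do rewrite mulr1; rewrite mu1.
Qed.

Lemma fib_map_eq n (E B : topologicalType) (f : E -> B)
    (mu : @fib_measures R n E B f) b :
  [set` supp (set_val mu)] `<=` f @^-1` [set b] -> fib_map mu = b.
Proof.
rewrite /fib_map; case: cid => b' /= hb' hb.
have [[_ _ mu1] _] := set_valP mu.
have [z zs] : exists z, z \in supp (set_val mu).
  apply: contrapT => ns; move: mu1; rewrite big_seq_cond big1 => [/eqP|z].
    by rewrite eq_sym oner_eq0.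
  by rewrite andbT => zs; case: ns; exists z.
by rewrite -(hb' z zs) (hb z zs).
Qed.

Lemma fib_map_supp n (E B : topologicalType) (f : E -> B)
    (mu : @fib_measures R n E B f) e :
  e \in supp (set_val mu) -> f e = fib_map mu.
Proof. by rewrite /fib_map; case: cid => b /= + es => /(_ e es). Qed.

End FiniteMeasures.

(** Outside [V] nothing is known about [h] but its bound; there [u] vanishes and makes the product
    small nearby. *)
Lemma cutoff_bounded_continuous (R : realType) (E : topologicalType)
    (V : set E) (u h : E -> R) M :
  continuous u -> (forall e, ~ V e -> u e = 0) -> (forall e, `|u e| <= 1) ->
  (forall e, V e -> {for e, continuous h}) -> (forall e, `|h e| <= M) ->
  bounded_continuous (fun e => u e * h e).
Proof.
move=> cu u0 u1 ch hM; split; last first.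
  exists M => e; rewrite normrM.
  by rewrite -[leRHS]mul1r; apply: ler_pM.
move=> e; have [Ve|nVe] := pselect (V e).
  by apply: continuousM; [exact: cu|exact: ch].
have M0 : 0 <= M by apply: le_trans (normr_ge0 _) (hM e).
rewrite /continuous_at (u0 e nVe) mul0r.
apply/cvgrPdist_lt => eps eps0.
(* [M] may be 0, so the division is by [M + 1]. *)
have M1 : 0 < M + 1 by lra.
have := cu e; rewrite /continuous_at (u0 e nVe) => /cvgrPdist_lt.
move=> /(_ _ (divr_gt0 eps0 M1)); apply: filterS => z.
rewrite !sub0r !normrN normrM ltr_pdivlMr// => uz.
apply: le_lt_trans uz; apply: ler_pM => //.
by apply: le_trans (hM z) _; lra.
Qed.

(** * Pushing a section of measures forward along the fibres *)

Section FibrewisePush.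
Context {R : realType} {E Y X : topologicalType}.
Variables (p : Y -> X) (q : E -> X) (q' : E -> Y) (n : nat).
Hypothesis hp : covering_map p.
Hypothesis cq : continuous q.
Hypothesis separated_X : forall (A : set X) (x : X), closed A -> ~ A x ->
  exists2 u : X -> R, continuous u &
    [/\ u x = 1, forall a, A a -> u a = 0 & forall z, `|u z| <= 1].
Variable f : Y -> E -> E.
Hypothesis q'f : forall y e, p y = q e -> q' (f y e) = y.
Hypothesis cf : forall (U : set X) (s : X -> Y) e, open U -> section_over p U s ->
  U (q e) -> {for e, continuous (fun e => f (s (q e)) e)}.

(** Continuity is tested near each [y0]. A test function [g] is pulled back through [f] along a
    local section [t] of [p], a cutoff [u] makes this a global test function, and the resulting
    integral is divided by [u (p y)]. *)
Lemma fibrewise_push_section :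
  has_section (@fib_map R n E X q) -> has_section (@fib_map R n E Y q').
Proof.
move=> [s cs sE].
pose m (x : X) : @fin_measure R E := set_val (s x).
have cm : continuous m.
  move=> x; apply: (continuous_comp (cs x)); exact: initial_continuous.
have qm x e : e \in supp (m x) -> q e = x.
  by move=> em; rewrite -(sE x); exact: fib_map_supp.
pose m' y := push (f y) (m (p y)).
have m'supp y : [set` supp (m' y)] `<=` q' @^-1` [set y].
  move=> z /= /push_supp /imfsetP[e /= em ->]; apply: q'f.
  by rewrite (qm _ _ em).
have m'P y : @fib_measures R n E Y q' (m' y).
  split; last by exists y.
  by apply: push_Bn; have [] := set_valP (s (p y)).
pose s' y : @fib_measures R n E Y q' := exist _ (m' y) (mem_set (m'P y)).
exists s'; last by move=> y; apply: fib_map_eq; exact: m'supp.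
apply: continuous_comp_initial; rewrite -[_ \o _]/m'.
apply/fin_integral_continuousP => g [cg [M gM]] y0.
have [U [oU Uy0 secU]] := covering_section hp (p y0).
have [t tU ty0] := secU y0 Uy0.
have [||u cu [u1 u0 ub]] := @separated_X (~` U) (p y0).
- exact: open_closedC.
- by [].
pose h e := g (f (t (q e)) e).
have bh : bounded_continuous (fun e => u (q e) * h e).
  apply: (@cutoff_bounded_continuous R E (q @^-1` U) (u \o q) h M) => //.
  - by move=> e; apply: continuous_comp; [exact: cq|exact: cu].
  - by move=> e nU; exact: u0.
  - by move=> e; exact: ub.
  - by move=> e Ue; apply: continuous_comp; [exact: (cf oU tU)|exact: cg].
  - by move=> e; exact: gM.
have cK := (fin_integral_continuousP m).1 cm _ bh.
(* The measure [m (p y)] lives on the fibre over [p y], where [u \o q] is constant and [h] is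
   [g \o f y]. *)
have KE y : t (p y) = y ->
    fin_integral (m (p y)) (fun e => u (q e) * h e) = u (p y) * fin_integral (m' y) g.
  move=> ty; rewrite fin_integral_push /fin_integral mulr_sumr big_seq [RHS]big_seq.
  by apply: eq_bigr => e em; rewrite /h /= (qm _ _ em) ty mulrCA.
have [cp _ _] := hp.
have cup : {for y0, continuous (u \o p)}.
  by apply: continuous_comp; [exact: cp|exact: cu].
have un0 : \forall y \near y0, u (p y) != 0.
  have nz : nbhs (u (p y0)) [set r : R | r != 0].
    by apply: open_nbhs_nbhs; split; [exact: open_neq|rewrite /= u1 oner_eq0].
  exact: cup _ nz.
pose K y := fin_integral (m (p y)) (fun e => u (q e) * h e).
have cKp : {for y0, continuous K}.
  exact: (continuous_comp (cp y0) (cK (p y0))).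
have near_eq : \forall y \near y0, K y / u (p y) = fin_integral (m' y) g.
  apply: filterS2 un0 (section_near hp oU tU Uy0 ty0) => y uy ty.
  by rewrite /K KE// mulrC mulKf.
have cKu : {for y0, continuous (fun y => K y / u (p y))}.
  apply: continuousM; first exact: cKp.
  by apply: continuousV; [rewrite u1 oner_eq0|exact: cup].
move=> W /=; rewrite -(nbhs_singleton near_eq) => /cKu nW.
have {}nW : \forall y \near y0, W (K y / u (p y)) by exact: nW.
by apply: filterS2 nW near_eq => y Wy yE; rewrite /preimage /= -yE.
Qed.

End FibrewisePush.

(** * Comparison of the categories *)

Lemma dcat1_le_covering (R : realType) (X Y : topologicalType) (p : Y -> X) n :
  @CW_complex R X -> connected_space Y -> covering_map p ->
  dcat1_le R X n -> dcat1_le R Y n.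
Proof.
move=> [c] [[y0 _] cY] hp [E [q [[hq scE] sec]]].
have lX := cw_locally_path_connected c.
have lE := covering_locally_path_connected hq lX.
have lY := covering_locally_path_connected hp lX.
have [cq rq _] := hq.
have [e0 _ qe0] : range q (p y0) by rewrite rq.
have [q' [cq' pq' q'e0]] := covering_lift hp scE lE cq (esym qe0).
have surj := intermediate_covering_surj hp hq cq' pq' e0 lY cY.
exists E, q'; split.
  by split; [exact: intermediate_covering hp hq lX cq' pq' surj|exact: scE].
apply: (@fibrewise_push_section R E Y X p q q' n.+1 hp cq _
  (translate e0 hp hq scE lE cq' pq' surj)) sec.
- by move=> A x cA nAx; exact: (cw_urysohn c cA nAx).
- by move=> y e ye; exact: (sheetP _ _ _ _ _ _ _ _ ye).2.
- by move=> U s e; exact: translate_continuous.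
Qed.

Theorem theorem3p16 (R : realType) (X Y : topologicalType) (p : Y -> X)
  (hXconn : connected_space X) (hXcw : @CW_complex R X)
  (hYconn : connected_space Y) (hYcw : @CW_complex R Y)
  (hp : covering_map p) :
  (dcat1 R Y <= dcat1 R X)%E.
Proof.
rewrite {2}/dcat1; case: pselect => [hX|_]; last exact: leey.
case: ex_minnP => n /asboolP nX _.
(* The least value for [X] is admissible for [Y], which makes the value for [Y] finite and no
   larger. *)
have nY := dcat1_le_covering hXcw hYconn hp nX.
rewrite /dcat1; case: pselect => [hY|]; last by case; exists n.
case: ex_minnP => k _ kmin; rewrite lee_fin ler_nat; apply: kmin.
exact/asboolP.
Qed.
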